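(* For $n\geq 1$ let $\mathsf{C}_n$ denote the tropical central path of the family of linear programs $(\mathrm{CEX}_n(t))_{t>1}$, and let $u_k := 3\cdot 2^{k-2}-1$ for $k \geq 1$. For all $\lambda\in\mathbb{R}$, $\mathsf{C}_1(\lambda) = \min(0,-\lambda)$, and for all $n>1$, $$\mathsf{C}_n(\lambda) = \begin{cases} 0 & \text{if } \lambda\leq 0,\\[4pt] \begin{bmatrix} (\mathsf{C}_{n-1}(\lambda))_{[n-2]} \\ 0 \\ -\lambda\end{bmatrix} & \text{if } 0\leq\lambda\leq u_n-1,\\[14pt] \begin{bmatrix} -u_{n-1}e\\ 0\\ -(u_n-1)\end{bmatrix} + \begin{bmatrix} \big[((u_n-1)-\lambda)\vee(-1)\big]e\\ (u_n-1)-\lambda\end{bmatrix} & \text{if } u_n-1\leq\lambda\leq u_n+1,\\[14pt] \begin{bmatrix} -(u_{n-1}+1)e\\ -1\\ -(u_n+1)\end{bmatrix} + \begin{bmatrix}\mathsf{C}_{n-1}(\lambda-(u_n+1))\\ u_n+1-\lambda\end{bmatrix} & \text{if } u_n+1\leq\lambda.\end{cases}$$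
   Context: $\mathbb{T} := \mathbb{R}\cup\{-\infty\}$, $a\vee b := \max(a,b)$. The symbol $e$ denotes an all-ones vector of the appropriate size: in the three-block column vectors the blocks have sizes $n-2$, $1$, $1$, and in the two-block column vectors they have sizes $n-1$ and $1$. For a vector $z$ of size $k$ and $I\subset\{1,\dots,k\}$, $z_I := (z_i)_{i\in I}$, and $[m] := \{1,\dots,m\}$. The tropical central path $\mathsf{C}_n$ is the map sending $\lambda\in\mathbb{R}$ to the entrywise supremum (the ''tropical barycenter'') of the set of points $x \in \mathbb{T}^n$ satisfying $x_n \leq -\lambda$ and $$\bigvee_{j = 1}^{i-1} (-u_i + x_j) \vee (-u_{i+1} + 1 + x_i) \leq \bigvee_{j = i+1}^{n-1} (-u_j + x_j) \vee x_n \vee (-u_n) \quad (i = 1, \dots, n-1),$$ $$\bigvee_{j = 1}^n x_j \leq 0, \qquad -\infty \leq x_1 \leq x_2 \leq \dots \leq x_{n-1} \leq u_n + x_n .$$ (These tropical inequalities define the limit, as $t\to\infty$, of the image under the entrywise map $\log_t$ of the feasible set of the linear program $\mathrm{CEX}_n(t)$: minimize $x_n$ subject to $t^{-u_i} (\sum_{j < i} x_j) + t^{-u_{i+1} + 1} x_i \leq \sum_{j = i+1}^{n-1} t^{-u_j} x_j + x_n + t^{-u_n}$ for $1\leq i\leq n-1$, $\sum_{j = 1}^n x_j \leq 1$, $0 \leq x_1 \leq \dots \leq x_{n-1} \leq t^{u_n} x_n$.) *)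

(* Defs.v *)
From HB Require Import structures.
From mathcomp Require Import all_boot all_order all_algebra.
From mathcomp Require Import all_classical all_reals.
From mathcomp Require Export ereal.
Set Implicit Arguments.
Unset Strict Implicit.
Unset Printing Implicit Defensive.
Import Order.TTheory GRing.Theory Num.Theory.
Local Open Scope classical_set_scope.
Local Open Scope ring_scope.
Local Open Scope ereal_scope.

(* The tropical semiring T = R u {-oo} is the part of [\bar R] that excludes
   +oo; tropical addition is [maxe], with neutral element -oo, and tropical
   multiplication is the addition of [\bar R]. *)
Definition tropical (R : realType) (n : nat) (x : 'cV[\bar R]_n) : Prop :=
  forall i : 'I_n, x i ord0 != +oo.

(* [coord x k] is the entry x_k in the 1-based numbering x_1, ..., x_n; it is
   only meaningful for 1 <= k <= n. *)
Definition coord (R : realType) (n : nat) (x : 'cV[\bar R]_n) (k : nat) :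
    \bar R :=
  if insub k.-1 is Some i then x i ord0 else -oo.

(* The exponent k - 2 is an integer: u_1 = 1/2, u_2 = 2, u_3 = 5, ... *)
Definition u (R : realType) (k : nat) : R :=
  (3 * 2 ^ (k%:Z - 2) - 1)%R.

Record trop_CEX_level (R : realType) (n : nat) (lambda : R)
    (x : 'cV[\bar R]_n) : Prop := TropCEXLevel {
  trop_points : tropical x;
  trop_level : coord x n <= (- lambda)%:E;
  trop_main : forall i : nat, (1 <= i < n)%N ->
    maxe (\big[maxe/-oo]_(1 <= j < i) ((- u R i)%:E + coord x j))
         ((- u R i.+1 + 1)%:E + coord x i)
    <= maxe (maxe (\big[maxe/-oo]_(i.+1 <= j < n) ((- u R j)%:E + coord x j))
                  (coord x n))
            (- u R n)%:E;
  trop_sum : \big[maxe/-oo]_(1 <= j < n.+1) coord x j <= 0;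
  trop_chain : forall i : nat, (1 <= i)%N -> (i.+1 < n)%N ->
    coord x i <= coord x i.+1;
  (* For n = 1 the chain has no variable on the left and imposes nothing. *)
  trop_chain_last : (1 < n)%N -> coord x n.-1 <= (u R n)%:E + coord x n
}.

Definition tropical_barycenter (R : realType) (n : nat)
    (X : set 'cV[\bar R]_n) : 'cV[\bar R]_n :=
  \col_i ereal_sup [set x i ord0 | x in X].

(* Meaningful for n >= 1. *)
Definition trop_central_path (R : realType) (n : nat) (lambda : R) :
    'cV[\bar R]_n :=
  tropical_barycenter [set x | trop_CEX_level lambda x].

(* The block column vector [v; a]. It avoids the cast from 'cV_(n + 1) to
   'cV_n.+1 that [col_mx] would require. *)
Definition snoc (R : realType) (n : nat) (v : 'cV[\bar R]_n) (a : \bar R) :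
    'cV[\bar R]_n.+1 :=
  \col_i (if unlift ord_max i is Some j then v j ord0 else a).

(* The subvector z_[n] of a vector z of size n + 1. *)
Definition drop_last (R : realType) (n : nat) (z : 'cV[\bar R]_n.+1) :
    'cV[\bar R]_n :=
  rowsub (widen_ord (leqnSn n)) z.

(* Main.v *)
Require Import Defs.
From HB Require Import structures.
From mathcomp Require Import all_boot all_order all_algebra.
From mathcomp Require Import all_classical all_reals.
From mathcomp Require Import ring lra zify.
Import Order.TTheory GRing.Theory Num.Theory.
Local Open Scope ring_scope.

(** The level set has a greatest element, which is then its barycenter: every
    inequality bounds a coordinate by coordinates of larger index.  This greatest
    element is built by induction on the dimension.  For lambda <= u_n - 1 the
    entry x_(n-1) may be 0 and acts in the main inequalities as the constant
    term -u_(n-1) of the problem of size n - 1, while x_n plays the role of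
    the last variable.  For lambda >= u_n + 1 the constant term -u_n dominates x_n,
    and adding u_(n-1) + 1 to x_1, ..., x_(n-2) and 1 to x_(n-1) gives the problem
    of size n - 1 with lambda shifted by u_n + 1, because u_n = 2 u_(n-1) + 1.  In
    between, x_1 = ... = x_(n-2), and all inequalities follow from the last ones. *)

(** * Recursion and bounds for the exponents [u_k] *)

Lemma u1 (R : realType) : u R 1 = 2^-1.
Proof. by rewrite /u (_ : 1%:Z - 2 = -1) // exprN1; lra. Qed.

Lemma uS (R : realType) k : u R k.+1 = 2 * u R k + 1.
Proof.
rewrite /u (_ : k.+1%:Z - 2 = 1 + (k%:Z - 2)); last by lia.
by rewrite expfzDr ?pnatr_eq0// expr1z; ring.
Qed.

Lemma u_gt0 (R : realType) k : 0 < u R k.+1.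
Proof. by elim: k => [|k IH]; [rewrite u1; lra | rewrite uS; lra]. Qed.

(** Makes the diagonal coefficients [- u_(i+1) + 1] of the main inequalities negative. *)
Lemma u_ge2 (R : realType) k : 2 <= u R k.+2.
Proof. by elim: k => [|k IH]; [rewrite uS u1; lra | rewrite uS; lra]. Qed.

(** * The inequalities over the reals and their greatest solution *)

(* [below_rhs n z i a] unfolds [a] being at most the right-hand side of the
   [i]-th main inequality at [z]. *)
Definition below_rhs {R : realType} (n : nat) (z : nat -> R) (i : nat) (a : R) :=
  [\/ a <= z n, a <= - u R n
    | exists2 j, (i < j < n)%N & a <= - u R j + z j].

(** The tropical constraints for points with real entries, numbered from 1 as in [coord]; values of
    [z] outside [1..n] are irrelevant. Each maximum on a left-hand side is split into one condition
    per term, so that linear arithmetic applies. *)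
Record feasible {R : realType} (n : nat) (lambda : R) (z : nat -> R) : Prop :=
  Feasible {
  feasible_level : z n <= - lambda;
  feasible_low : forall i j, (0 < j)%N -> (j < i)%N -> (i < n)%N ->
    below_rhs n z i (- u R i + z j);
  feasible_diag : forall i, (0 < i)%N -> (i < n)%N ->
    below_rhs n z i (- u R i.+1 + 1 + z i);
  feasible_le0 : forall k, (0 < k)%N -> (k <= n)%N -> z k <= 0;
  feasible_chain : forall k, (0 < k)%N -> (k.+1 < n)%N -> z k <= z k.+1;
  feasible_last : (1 < n)%N -> z n.-1 <= u R n + z n
}.

Definition greatest_feasible {R : realType} (n : nat) (lambda : R)
    (g : nat -> R) : Prop :=
  feasible n lambda g /\
  forall z, feasible n lambda z -> forall k, (0 < k)%N -> (k <= n)%N -> z k <= g k.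

Definition real_col {R : realType} (n : nat) (z : nat -> R) : 'cV[\bar R]_n :=
  \col_i (z i.+1)%:E.

(** * Entries of columns and bounds on finite tropical sums *)

Lemma coord_real_col {R : realType} n (z : nat -> R) k :
  (0 < k)%N -> (k <= n)%N -> Defs.coord (real_col n z) k = (z k)%:E.
Proof.
case: k => // k _ kn; rewrite /Defs.coord /=.
by case: insubP => [i _ /= <-|]; [rewrite mxE | rewrite kn].
Qed.

Lemma coord_ord {R : realType} n (x : 'cV[\bar R]_n) (i : 'I_n) :
  Defs.coord x i.+1 = x i ord0.
Proof. by rewrite /Defs.coord /= valK. Qed.

Lemma coord_ltpinfty {R : realType} n (x : 'cV[\bar R]_n) k :
  tropical x -> Defs.coord x k != +oo%E.
Proof. by move=> tx; rewrite /Defs.coord; case: insub. Qed.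

Lemma bigmaxe_nat_leP {R : realType} m n (F : nat -> \bar R) (a : \bar R) :
  (\big[maxe/-oo]_(m <= j < n) F j <= a)%E <->
  (forall j, (m <= j < n)%N -> (F j <= a)%E).
Proof.
suff H r : (\big[maxe/-oo]_(j <- r) F j <= a)%E <->
    {in r, forall j, (F j <= a)%E}.
  by rewrite H; split=> Fa j; move: (Fa j); rewrite mem_index_iota.
elim: r => [|k r IH]; first by rewrite big_nil leNye.
rewrite big_cons ge_max; split.
- by move=> /andP[ka /IH ra] j; rewrite inE => /predU1P[->//|/ra].
- move=> H; rewrite H ?mem_head//=; apply/IH => j jr.
  by apply: H; rewrite inE jr orbT.
Qed.

(** A nonempty finite maximum is attained. Taking [a] real excludes the empty range, whose maximum
    is [-oo]. *)
Lemma bigmaxe_nat_geP {R : realType} m n (F : nat -> \bar R) (a : R) :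
  (a%:E <= \big[maxe/-oo]_(m <= j < n) F j)%E <->
  (exists2 j, (m <= j < n)%N & (a%:E <= F j)%E).
Proof.
split; last first.
  case=> j jmn aF; apply: le_trans aF _.
  by have /bigmaxe_nat_leP := lexx (\big[maxe/-oo]_(m <= j < n) F j)%E; exact.
rewrite big_seq; elim/big_ind : _ => //.
- by move=> x y xH yH; rewrite le_max => /orP[/xH|/yH].
- by move=> j; rewrite mem_index_iota => jmn aF; exists j.
Qed.

(** * From the tropical level set to real points *)

Lemma feasible_real_col {R : realType} n (lambda : R) z :
  (0 < n)%N -> feasible n lambda z -> trop_CEX_level lambda (real_col n z).
Proof.
move=> n0 [zl zlow zdiag z0 zch zla].
have rhsE i (a : R) : (0 < i)%N -> below_rhs n z i a ->
  (a%:E <= maxe (maxe (\big[maxe/-oo]_(i.+1 <= j < n)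
                         ((- u R j)%:E + Defs.coord (real_col n z) j))
                      (Defs.coord (real_col n z) n)) (- u R n)%:E)%E.
  move=> i0; rewrite !le_max => -[az|au|[j /andP[ij jn] aj]].
  - by rewrite coord_real_col// lee_fin az orbT.
  - by rewrite lee_fin au orbT.
  - apply/orP; left; apply/orP; left.
    apply/bigmaxe_nat_geP; exists j; first by rewrite ij jn.
    by rewrite (coord_real_col _ _ _ (leq_ltn_trans (leq0n i) ij) (ltnW jn)).
split.
- by move=> i; rewrite mxE.
- by rewrite coord_real_col.
- move=> i /andP[i0 iN]; rewrite ge_max; apply/andP; split.
  + apply/bigmaxe_nat_leP => j /andP[j0 ji].
    rewrite (coord_real_col _ _ _ j0 (ltnW (ltn_trans ji iN))).
    by apply: rhsE => //; exact: zlow.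
  + rewrite (coord_real_col _ _ _ i0 (ltnW iN)).
    by apply: rhsE => //; exact: zdiag.
- apply/bigmaxe_nat_leP => j /andP[j0 jn].
  by rewrite coord_real_col// lee_fin; exact: z0.
- move=> i i0 iN; rewrite (coord_real_col _ _ _ _ (ltnW iN))// (coord_real_col _ _ _ i0 (ltnW (ltnW iN))).
  by rewrite lee_fin; exact: zch.
- move=> n1; rewrite !coord_real_col//; last 2 first.
  + by case: n n1 {n0 zl zlow zdiag z0 zch zla rhsE} => [|[]].
  + exact: leq_pred.
  by rewrite -EFinD lee_fin; exact: zla.
Qed.

(* Constant vectors below [- lambda] and [- u_n] lie in the level set, which is
   stable under maxima; this gets rid of the entries equal to -oo. *)
Lemma trop_CEX_level_trunc {R : realType} n (lambda c : R) (x : 'cV[\bar R]_n) :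
  (0 < n)%N -> c <= - lambda -> c <= - u R n -> trop_CEX_level lambda x ->
  feasible n lambda (fun k => fine (maxe (Defs.coord x k) c%:E)).
Proof.
case: n x => // n x _ cl cu [tx xl xm xs xch xla].
set z := fun k => _.
have zE k : (z k)%:E = maxe (Defs.coord x k) c%:E.
  rewrite /z; have := coord_ltpinfty _ x k tx.
  by case: (Defs.coord x k) => [r||]// _; rewrite -?EFin_max// max_r// leNye.
have un := u_gt0 R n.
have u0 k : (0 < k)%N -> 0 < u R k by case: k => // k _; exact: u_gt0.
(* If the entry was raised to [c], the left-hand side is at most [c], hence at most the constant
   term. Otherwise it is unchanged, while the right-hand side can only grow. *)
have rhsE i (a k : R) (j : nat) : (0 < i < n.+1)%N -> 0 <= k -> a = - k + z j ->
  ((- k)%:E + Defs.coord x j <= maxe (maxe (\big[maxe/-oo]_(i.+1 <= j < n.+1)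
                         ((- u R j)%:E + Defs.coord x j))
                      (Defs.coord x n.+1)) (- u R n.+1)%:E)%E -> below_rhs n.+1 z i a.
  move=> /andP[i0 iN] k0 ->.
  have [xc|cx] := leP (Defs.coord x j) c%:E.
    have zjc : z j = c by apply: EFin_inj; rewrite zE max_r.
    by move=> _; apply: Or32; rewrite zjc; lra.
  have zx : (z j)%:E = Defs.coord x j by rewrite zE max_l// ltW.
  rewrite -zx -EFinD 2!le_max => /orP[/orP[|]|].
  - move=> /bigmaxe_nat_geP[l /andP[il lN] H].
    apply: Or33; exists l; first by rewrite il.
    by rewrite -lee_fin EFinD (EFinD (- u R l)); apply: le_trans H _;
      rewrite zE leeD2l// le_max lexx.
  - by move=> H; apply: Or31; rewrite -lee_fin (zE n.+1); apply: le_trans H _; rewrite le_max lexx.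
  - by rewrite lee_fin => H; apply: Or32.
split.
- by rewrite -lee_fin zE ge_max xl lee_fin.
- move=> i j j0 ji iN.
  have i0 := ltn_trans j0 ji.
  apply: (rhsE i _ (u R i) j) => //; [by rewrite i0 | exact/ltW/u0 |].
  have := xm i; rewrite i0 iN => /(_ isT); rewrite ge_max => /andP[+ _].
  by move/bigmaxe_nat_leP; apply; rewrite j0.
- move=> i i0 iN.
  apply: (rhsE i _ (u R i.+1 - 1) i) => //; first by rewrite i0.
  + by case: i i0 {iN} => // i _; have := u_ge2 R i; lra.
  + lra.
  + have := xm i; rewrite i0 iN => /(_ isT); rewrite ge_max => /andP[_].
    by rewrite (_ : - (u R i.+1 - 1) = - u R i.+1 + 1); last by ring.
- move=> k k0 kn; rewrite -lee_fin zE ge_max lee_fin; apply/andP; split; last by lra.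
  by move/bigmaxe_nat_leP : xs; apply; rewrite k0.
- move=> k k0 kn; rewrite -lee_fin !zE ge_max !le_max lexx orbT andbT.
  by rewrite xch.
- move=> n1; rewrite -lee_fin EFinD !zE ge_max; apply/andP; split.
  + by apply: le_trans (xla n1) _; rewrite leeD2l// le_max lexx.
  + apply: (@le_trans _ _ ((u R n.+1)%:E + c%:E)%E).
      by rewrite -EFinD lee_fin; lra.
    by rewrite leeD2l// le_max lexx orbT.
Qed.

(** The supremum is attained at [g]: [g] lies in the level set, and each point of the level set is
    dominated by its truncation, which is real and so lies below [g]. *)
Lemma trop_central_pathE {R : realType} n (lambda : R) g :
  (0 < n)%N -> greatest_feasible n lambda g ->
  trop_central_path n lambda = real_col n g.
Proof.
move=> n0 [gf gmax]; apply/matrixP => i j; rewrite ord1 !mxE {j}.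
apply/eqP; rewrite eq_le; apply/andP; split.
- apply: ge_ereal_sup => _ [x xl <-].
  pose c := Num.min (- lambda) (- u R n).
  have cl : c <= - lambda by rewrite ge_min lexx.
  have cu : c <= - u R n by rewrite ge_min lexx orbT.
  have := gmax _ (trop_CEX_level_trunc n lambda c x n0 cl cu xl) i.+1 isT (ltn_ord i).
  rewrite coord_ord -lee_fin fineK; last first.
    rewrite fin_numE; case: xl => /(_ i) + _ _ _ _ _.
    by case: (x i ord0) => [r _|//|_]; [rewrite -EFin_max | rewrite max_r ?leNye].
  by apply: le_trans; rewrite le_max lexx.
- apply: ereal_sup_ubound; exists (real_col n g); last by rewrite mxE.
  exact: feasible_real_col.
Qed.

(** * Extending a vector by two entries *)

(** The value [b] is also taken at every index beyond [n.+2]. For vectors of size [n.+1] only [a]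
    matters and [b] is a dummy. *)
Definition append2 {R : realType} (n : nat) (f : nat -> R) (a b : R) (k : nat) : R :=
  if (k <= n)%N then f k else if k == n.+1 then a else b.

Lemma append2_low {R : realType} n (f : nat -> R) a b k :
  (k <= n)%N -> append2 n f a b k = f k.
Proof. by rewrite /append2 => ->. Qed.

Lemma append2_mid {R : realType} n (f : nat -> R) a b : append2 n f a b n.+1 = a.
Proof. by rewrite /append2 ltnn eqxx. Qed.

Lemma append2_last {R : realType} n (f : nat -> R) a b : append2 n f a b n.+2 = b.
Proof. by rewrite /append2 ltnNge leqnSn /= eqSS gtn_eqF. Qed.

Lemma snoc2E {R : realType} n (f : nat -> R) (a b : R) :
  snoc (snoc (real_col n f) a%:E) b%:E = real_col n.+2 (append2 n f a b).
Proof.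
apply/matrixP => i j; rewrite !mxE {j}.
case: unliftP => [j ->|->]; last by rewrite append2_last.
rewrite mxE; case: unliftP => [l ->|->].
  by rewrite mxE !lift_max append2_low.
by rewrite lift_max append2_mid.
Qed.

Lemma feasible_mono {R : realType} n (lambda : R) z j k :
  feasible n lambda z -> (0 < j)%N -> (j <= k)%N -> (k < n)%N -> z j <= z k.
Proof.
move=> zf j0; elim: k => [|k IH]; first by rewrite leqNgt j0.
rewrite leq_eqVlt => /predU1P[<-//|]; rewrite ltnS => jk kn.
apply: le_trans (IH jk (ltnW kn)) _.
by apply: (feasible_chain _ _ _ zf) => //; exact: leq_trans jk.
Qed.

(** * Greatest points in each range of [lambda] *)

Lemma greatest_feasible_one {R : realType} (lambda : R) :
  greatest_feasible 1 lambda (fun=> Num.min 0 (- lambda)).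
Proof.
split.
  split.
  - by rewrite ge_min lexx orbT.
  - by move=> i j j0 ji; lia.
  - by move=> [].
  - by move=> k _ _; rewrite ge_min lexx.
  - by move=> k; rewrite ltnS ltn0.
  - by [].
move=> z zf [|[|k]]// _ _; rewrite le_min (feasible_level _ _ _ zf) andbT.
exact: (feasible_le0 _ _ _ zf).
Qed.

(** All left-hand coefficients are negative, so at the zero vector the term [x_n = 0] alone
    satisfies each main inequality. *)
Lemma greatest_feasible_le0 {R : realType} n (lambda : R) : lambda <= 0 ->
  greatest_feasible n.+1 lambda (fun=> 0).
Proof.
move=> l0; split; last by move=> z zf; exact: (feasible_le0 _ _ _ zf).
split=> //.
- by lra.
- move=> [//|i] j _ _ _; apply: Or31; have := u_gt0 R i; lra.
- move=> [//|i] _ _; apply: Or31; have := u_ge2 R i; lra.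
- by move=> _; have := u_gt0 R n; lra.
Qed.

Lemma greatest_feasible_low {R : realType} n (lambda : R) g :
  0 <= lambda <= u R n.+2 - 1 -> greatest_feasible n.+1 lambda g ->
  greatest_feasible n.+2 lambda (append2 n g 0 (- lambda)).
Proof.
move=> /andP[l0 lu] [gf gmax].
have un := u_gt0 R n; have uSn := uS R n.+1.
split.
  have gl := feasible_level _ _ _ gf.
  (* The old last entry is at most [- lambda], the new one; the old constant [- u R n.+1] is now the
     term of the entry 0 at index [n.+1]. *)
  have T i a : below_rhs n.+1 g i a -> (i <= n)%N ->
      below_rhs n.+2 (append2 n g 0 (- lambda)) i a.
    move=> [H|H|[l /andP[il ln] H]] iN.
    - by apply: Or31; rewrite append2_last; lra.
    - by apply: Or33; exists n.+1; [lia | rewrite append2_mid; lra].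
    - by apply: Or33; exists l; [lia | rewrite append2_low].
  split.
  - by rewrite append2_last.
  - move=> i j j0 ji iN; rewrite (append2_low n g _ _ j); last by lia.
    have [iNn|iNn] := leqP i n.
      by apply: T => //; exact: (feasible_low _ _ _ gf).
    (* Here the claim follows from the last chain inequality of the smaller problem together with
       monotonicity. *)
    have -> : i = n.+1 by lia.
    apply: Or31; rewrite append2_last.
    have jn : (j <= n)%N by lia.
    have := feasible_mono _ _ _ _ n gf j0 jn (ltnSn n).
    have : (1 < n.+1)%N by lia.
    by move=> /(feasible_last _ _ _ gf) /=; lra.
  - move=> i i0 iN; have [iNn|iNn] := leqP i n.
      rewrite append2_low//; apply: T => //; exact: (feasible_diag _ _ _ gf).
    (* The inequality becomes [lambda <= u R n.+2 - 1], the upper end of the range. *)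
    have -> : i = n.+1 by lia.
    by apply: Or31; rewrite append2_mid append2_last; lra.
  - move=> k k0 kn; have [kNn|kNn] := leqP k n.
      by rewrite append2_low//; apply: (feasible_le0 _ _ _ gf) => //; lia.
    have [->|->] : k = n.+1 \/ k = n.+2 by lia.
      by rewrite append2_mid.
    by rewrite append2_last; lra.
  - move=> k k0 kn; rewrite append2_low; last by lia.
    have [kNn|kNn] := leqP k.+1 n.
      by rewrite append2_low//; apply: (feasible_chain _ _ _ gf).
    have -> : k.+1 = n.+1 by lia.
    rewrite append2_mid; apply: (feasible_le0 _ _ _ gf) => //; lia.
  - by move=> _; rewrite append2_mid append2_last; lra.
move=> z zf k k0 kn; have zl := feasible_level _ _ _ zf.
have [kNn|kNn] := leqP k n; last first.
  have [->|->] : k = n.+1 \/ k = n.+2 by lia.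
    by rewrite append2_mid; apply: (feasible_le0 _ _ _ zf).
  by rewrite append2_last.
(* For maximality, the entries [n.+1] and [n.+2] of [z] are replaced by the single last entry
   [- lambda]; the 0 is a dummy. *)
rewrite append2_low//; pose y := append2 n z (- lambda) 0.
have <- : y k = z k by rewrite /y append2_low.
apply: gmax => //; last by lia.
have T i a : below_rhs n.+2 z i a -> below_rhs n.+1 y i a.
  move=> [H|H|[l /andP[il ln] H]].
  - by apply: Or31; rewrite /y append2_mid; lra.
  - by apply: Or31; rewrite /y append2_mid; lra.
  - have [lN|lN] := leqP l n.
      by apply: Or33; exists l; [lia | rewrite /y append2_low].
    have lE : l = n.+1 by lia.
    apply: Or32; move: H; rewrite lE.
    by have := feasible_le0 _ _ _ zf n.+1 isT (leqnSn _); lra.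
split.
- by rewrite /y append2_mid.
- move=> i j j0 ji iN; apply: T; rewrite /y append2_low; last by lia.
  by apply: (feasible_low _ _ _ zf) => //; lia.
- move=> i i0 iN; apply: T; rewrite /y append2_low; last by lia.
  by apply: (feasible_diag _ _ _ zf) => //; lia.
- move=> l l0' ln; have [lN|lN] := leqP l n.
    by rewrite /y append2_low//; apply: (feasible_le0 _ _ _ zf) => //; lia.
  have -> : l = n.+1 by lia.
  by rewrite /y append2_mid; lra.
- move=> l l0' ln; rewrite /y !append2_low; try lia.
  by apply: (feasible_chain _ _ _ zf) => //; lia.
- move=> n1 /=; rewrite /y append2_mid append2_low//.
  have n0 : (0 < n)%N by lia.
  (* At index [n.+1] the right-hand side has no terms [- u_j + z_j]; what remains is at most
     [- lambda]. *)
  have := feasible_low _ _ _ zf n.+1 n n0 (ltnSn n) (ltnSn n.+1).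
  by move=> [H|H|[l Hl]]; [lra | lra | lia].
Qed.

(** The main inequality of index [n.+1] has right-hand side at most the maximum of [- lambda] and
    [- u_(n+2)], which is [m - (u_(n+2) - 1)]. It thus bounds [x_(n+1)] by [m] and, since
    [u_(n+2) - 1 = 2 u_(n+1)], the earlier entries by [m - u_(n+1)]. *)
Lemma greatest_feasible_mid {R : realType} n (lambda : R) :
  u R n.+2 - 1 <= lambda <= u R n.+2 + 1 ->
  let m := Num.max ((u R n.+2 - 1) - lambda) (- 1) in
  greatest_feasible n.+2 lambda
    (append2 n (fun=> - u R n.+1 + m) m (- lambda)).
Proof.
move=> /andP[lu ul] m.
have un := u_gt0 R n; have uSn := uS R n.+1.
have m1 : - 1 <= m by rewrite /m le_max lexx orbT.
have ml : u R n.+2 - 1 - lambda <= m by rewrite /m le_max lexx.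
have mE : m = u R n.+2 - 1 - lambda \/ m = - 1.
  by rewrite /m; case: leP => _; [right | left].
set h := append2 _ _ _ _.
have hlow k : (k <= n)%N -> h k = - u R n.+1 + m by move=> kn; rewrite /h append2_low.
have hmid : h n.+1 = m by rewrite /h append2_mid.
have hlast : h n.+2 = - lambda by rewrite /h append2_last.
clearbody h; clearbody m.
split.
  split.
  - by rewrite hlast.
  - move=> [//|i] j j0 ji iN; rewrite (hlow j); last by lia.
    have ui := u_gt0 R i.
    have [iNn|iNn] := ltnP i n.
      (* The term of index [n.+1] on the right equals the common value of the first [n] entries. *)
      by apply: Or33; exists n.+1; [lia | rewrite hmid; lra].
    have -> : i = n by lia.
    by case: mE => mE; [apply: Or31; rewrite hlast | apply: Or32]; lra.
  - move=> [//|i] i0 iN; have ui := u_ge2 R i; have [iNn|iNn] := ltnP i n.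
      by apply: Or33; exists n.+1; [lia | rewrite hlow// hmid; lra].
    have -> : i = n by lia.
    by rewrite hmid; case: mE => mE; [apply: Or31; rewrite hlast | apply: Or32]; lra.
  - move=> k k0 kn; have [kNn|kNn] := leqP k n.
      by rewrite hlow//; case: mE => mE; lra.
    have [->|->] : k = n.+1 \/ k = n.+2 by lia.
      by rewrite hmid; case: mE => mE; lra.
    by rewrite hlast; lra.
  - move=> k k0 kn; rewrite hlow; last by lia.
    have [kNn|kNn] := leqP k.+1 n; first by rewrite hlow.
    have -> : k.+1 = n.+1 by lia.
    by rewrite hmid; lra.
  (* When [m = - 1] this is [lambda <= u R n.+2 + 1], the upper end of the range. *)
  - by move=> _; rewrite hmid hlast; case: mE => mE; lra.
move=> z zf k k0 kn; have zl := feasible_level _ _ _ zf.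
have [kNn|kNn] := leqP k n.
  rewrite hlow//.
  have := feasible_low _ _ _ zf n.+1 k k0 kNn (ltnSn n.+1).
  by move=> [H|H|[l Hl]]; [lra | lra | lia].
have [->|->] : k = n.+1 \/ k = n.+2 by lia.
  rewrite hmid; have := feasible_diag _ _ _ zf n.+1 isT (ltnSn n.+1).
  by move=> [H|H|[l Hl]]; [lra | lra | lia].
by rewrite hlast.
Qed.

(** The translation exchanges the roles of the constraints: the last chain inequality becomes the
    level bound, [x_n <= x_(n+1)] becomes the last chain inequality, and the main inequality of
    index [n.+1] becomes nonpositivity of the entries. *)
Lemma greatest_feasible_high {R : realType} n (lambda : R) g :
  u R n.+2 + 1 <= lambda ->
  greatest_feasible n.+1 (lambda - (u R n.+2 + 1)) g ->
  greatest_feasible n.+2 lambda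
    (append2 n (fun k => - (u R n.+1 + 1) + g k) (- 1 + g n.+1) (- lambda)).
Proof.
move=> lu [gf gmax].
have un := u_gt0 R n; have uSn := uS R n.+1.
have gl := feasible_level _ _ _ gf.
split.
  set h := append2 _ _ _ _.
  have hlow k : (k <= n)%N -> h k = - (u R n.+1 + 1) + g k.
    by move=> kn; rewrite /h append2_low.
  have hmid : h n.+1 = - 1 + g n.+1 by rewrite /h append2_mid.
  have hlast : h n.+2 = - lambda by rewrite /h append2_last.
  clearbody h.
  have g0 k : (0 < k)%N -> (k <= n.+1)%N -> g k <= 0.
    exact: (feasible_le0 _ _ _ gf).
  have T i a : below_rhs n.+1 g i a -> (i <= n)%N ->
      below_rhs n.+2 h i (- (u R n.+1 + 1) + a).
    move=> [H|H|[l /andP[il ln] H]] iN.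
    - by apply: Or33; exists n.+1; [lia | rewrite hmid; lra].
    - by apply: Or32; lra.
    - by apply: Or33; exists l; [lia | rewrite hlow//; lra].
  split.
  - by rewrite hlast.
  - move=> i j j0 ji iN; rewrite (hlow j); last by lia.
    have [iNn|iNn] := leqP i n.
      by rewrite addrCA; apply: T => //; exact: (feasible_low _ _ _ gf).
    have -> : i = n.+1 by lia.
    apply: Or32; have jn : (j <= n.+1)%N by lia.
    by have := g0 j j0 jn; lra.
  - move=> i i0 iN; have [iNn|iNn] := leqP i n.
      by rewrite hlow// addrCA; apply: T => //; exact: (feasible_diag _ _ _ gf).
    have -> : i = n.+1 by lia.
    by apply: Or32; rewrite hmid; have := g0 n.+1 isT (leqnn _); lra.
  - move=> k k0 kn; have [kNn|kNn] := leqP k n.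
      by rewrite hlow//; have := g0 k k0 (leqW kNn); lra.
    have [->|->] : k = n.+1 \/ k = n.+2 by lia.
      by rewrite hmid; have := g0 n.+1 isT (leqnn _); lra.
    by rewrite hlast; lra.
  - move=> k k0 kn; rewrite hlow; last by lia.
    have [kNn|kNn] := leqP k.+1 n.
      by rewrite hlow// lerD2l; apply: (feasible_chain _ _ _ gf).
    have kE : k = n by lia.
    rewrite kE hmid in k0 *.
    (* [k0 : 0 < n] is convertible to the required [1 < n.+1]. *)
    by have := feasible_last _ _ _ gf k0; rewrite /=; lra.
  - by move=> _; rewrite hmid hlast; lra.
move=> z zf k k0 kn; have zl := feasible_level _ _ _ zf.
have zmid : z n.+1 <= u R n.+2 + z n.+2 := feasible_last _ _ _ zf isT.
have [->|kn2] := eqVneq k n.+2; first by rewrite append2_last.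
(* The inverse translation, with a dummy 0 beyond the last entry. *)
pose y := append2 n (fun k => u R n.+1 + 1 + z k) (1 + z n.+1) 0.
have ylow l : (l <= n)%N -> y l = u R n.+1 + 1 + z l.
  by move=> ln; rewrite /y append2_low.
have ymid : y n.+1 = 1 + z n.+1 by rewrite /y append2_mid.
clearbody y.
suff yf : feasible n.+1 (lambda - (u R n.+2 + 1)) y.
  have kn1 : (k <= n.+1)%N by lia.
  have := gmax _ yf k k0 kn1.
  have [kNn|kNn] := leqP k n; first by rewrite ylow// append2_low//; lra.
  have -> : k = n.+1 by lia.
  by rewrite ymid append2_mid; lra.
(* After adding [u_(n+1) + 1], the constant [- u_(n+2)] becomes [- u_(n+1)] and the term of
   [z_(n+1)] becomes the last variable [y_(n+1)]; [z_(n+2) <= - lambda] lies below the constant. *)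
have T i a : below_rhs n.+2 z i a -> below_rhs n.+1 y i (u R n.+1 + 1 + a).
  move=> [H|H|[l /andP[il ln] H]].
  - by apply: Or32; lra.
  - by apply: Or32; lra.
  - have [lN|lN] := leqP l n.
      by apply: Or33; exists l; [lia | rewrite ylow//; lra].
    have lE : l = n.+1 by lia.
    by apply: Or31; move: H; rewrite lE ymid; lra.
split.
- by rewrite ymid; lra.
- move=> i j j0 ji iN; rewrite ylow; last by lia.
  by rewrite addrCA; apply: T; apply: (feasible_low _ _ _ zf) => //; lia.
- move=> i i0 iN; rewrite ylow; last by lia.
  by rewrite addrCA; apply: T; apply: (feasible_diag _ _ _ zf) => //; lia.
- move=> l l0' ln; have [lN|lN] := leqP l n.
    rewrite ylow//; have := feasible_low _ _ _ zf n.+1 l l0' lN (ltnSn n.+1).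
    by move=> [H|H|[j Hj]]; [lra | lra | lia].
  have -> : l = n.+1 by lia.
  by rewrite ymid; lra.
- move=> l l0' ln; rewrite !ylow; try lia.
  by rewrite lerD2l; apply: (feasible_chain _ _ _ zf) => //; lia.
- move=> n1 /=; rewrite ymid ylow//.
  have n0 : (0 < n)%N by lia.
  by have := feasible_chain _ _ _ zf n n0 (ltnSn _); lra.
Qed.

(** * Existence in every dimension and the recursion *)

(** Two of the recursive cases start from a greatest point of the smaller problem; the four ranges
    cover all [lambda]. *)
Lemma greatest_feasible_exists {R : realType} n (lambda : R) :
  exists g, greatest_feasible n.+1 lambda g.
Proof.
elim: n lambda => [|n IH] lambda.
  by eexists; exact: greatest_feasible_one.
have [l0|l0] := leP lambda 0; first by eexists; exact: greatest_feasible_le0.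
have [lu|ul] := leP lambda (u R n.+2 - 1).
  have [g /greatest_feasible_low gg] := IH lambda.
  by eexists; apply: gg; rewrite ltW.
have [lu|ul'] := leP lambda (u R n.+2 + 1).
  by eexists; apply: greatest_feasible_mid; rewrite ltW.
have [g /greatest_feasible_high gg] := IH (lambda - (u R n.+2 + 1)).
by eexists; apply: gg; rewrite ltW.
Qed.

Theorem proposition23 (R : realType) :
  (forall lambda : R,
     trop_central_path 1 lambda = const_mx (Num.min 0 (- lambda))%:E) /\
  (forall (n : nat) (lambda : R),
     [/\ lambda <= 0 ->
           trop_central_path n.+2 lambda = const_mx 0%:E,
         0 <= lambda <= u R n.+2 - 1 ->
           trop_central_path n.+2 lambda =
             snoc (snoc (drop_last (trop_central_path n.+1 lambda)) 0%:E)
                  (- lambda)%:E,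
         u R n.+2 - 1 <= lambda <= u R n.+2 + 1 ->
           trop_central_path n.+2 lambda =
             snoc (snoc (const_mx (- u R n.+1)%:E : 'cV_n) 0%:E)
                  (- (u R n.+2 - 1))%:E
             + snoc (const_mx (Num.max ((u R n.+2 - 1) - lambda) (- 1))%:E
                       : 'cV_n.+1)
                    ((u R n.+2 - 1) - lambda)%:E
       & u R n.+2 + 1 <= lambda ->
           trop_central_path n.+2 lambda =
             snoc (snoc (const_mx (- (u R n.+1 + 1))%:E : 'cV_n) (- 1)%:E)
                  (- (u R n.+2 + 1))%:E
             + snoc (trop_central_path n.+1 (lambda - (u R n.+2 + 1)))
                    (u R n.+2 + 1 - lambda)%:E]).
Proof.
have constE n (a : R) : real_col n (fun=> a) = const_mx a%:E.
  by apply/matrixP => i j; rewrite !mxE.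
split=> [lambda|n lambda].
  by rewrite (trop_central_pathE _ _ _ _ (greatest_feasible_one lambda)) ?constE.
split=> H.
- by rewrite (trop_central_pathE _ _ _ _ (greatest_feasible_le0 n.+1 _ H)) ?constE.
- have [g gg] := greatest_feasible_exists n lambda.
  rewrite (trop_central_pathE _ _ _ _ gg)//.
  rewrite (trop_central_pathE _ _ _ _ (greatest_feasible_low _ _ _ H gg))//.
  rewrite -snoc2E; congr (snoc (snoc _ _) _).
  by apply/matrixP => i j; rewrite !mxE.
- rewrite (trop_central_pathE _ _ _ _ (greatest_feasible_mid _ _ H))// -snoc2E.
  apply/matrixP => i j; rewrite !mxE {j}.
  case: unliftP => [j _|_]; last by rewrite -EFinD; congr EFin; ring.
  rewrite !mxE; case: unliftP => [l _|_]; rewrite ?mxE -EFinD; congr EFin; ring.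
- have [g gg] := greatest_feasible_exists n (lambda - (u R n.+2 + 1)).
  rewrite (trop_central_pathE _ _ _ _ gg)//.
  rewrite (trop_central_pathE _ _ _ _ (greatest_feasible_high _ _ _ H gg))// -snoc2E.
  apply/matrixP => i j; rewrite !mxE {j}.
  case: unliftP => [j _|_]; last by rewrite -EFinD; congr EFin; ring.
  rewrite !mxE; case: unliftP => [l ->|->]; rewrite ?mxE -EFinD ?lift_max; congr EFin; ring.
Qed.
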